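(* The maximum exact $k$-composition ordering problem, when all input functions are monotone nondecreasing linear functions $f_i(x)=a_ix+b_i$ with $a_i\ge 0$ ($i\in[n]$), is solvable in $O(k\cdot n^2)$ time.
   Context: Let $[n]=\{1,\dots,n\}$. Given real functions $f_1,\dots,f_n:\mathbb{R}\to\mathbb{R}$, a constant $c\in\mathbb{R}$ and an integer $k$ with $0\le k\le n$, the maximum exact $k$-composition ordering problem asks for a permutation $\sigma:[n]\to[n]$ maximizing $f_{\sigma(k)}\circ f_{\sigma(k-1)}\circ\dots\circ f_{\sigma(1)}(c)$. *)

(* Defs.v *)
From HB Require Import structures.
From mathcomp Require Import all_boot all_order all_algebra all_fingroup reals.

Set Implicit Arguments.
Unset Strict Implicit.
Unset Printing Implicit Defensive.

Import Order.TTheory GRing.Theory Num.Theory.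
Local Open Scope ring_scope.

(** The index set [{1, ..., n}] is ['I_n], so indices are shifted by one: the function applied first is
  [f (s 0)], the last one [f (s (k - 1))]. *)

Definition compose_value (R : realType) (n : nat) (f : 'I_n -> R -> R) (c : R)
    (k : nat) (s : 'S_n) : R :=
  foldl (fun x i => f (s i) x) c (take k (enum 'I_n)).

Definition max_exact_composition (R : realType) (n : nat) (f : 'I_n -> R -> R)
    (c : R) (k : nat) (s : 'S_n) : Prop :=
  forall s' : 'S_n, compose_value f c k s' <= compose_value f c k s.

(** The model of computation is a real RAM, presented as a structured imperative language.  The memory
  consists of arrays named by natural numbers, each indexed by all natural
  numbers; a program names only finitely many of them.  There are separate
  arrays of natural numbers (for indices, counters and pointers) and of exact
  real numbers.

  What keeps the unit cost honest: natural numbers can only be added,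
  subtracted and compared; there is no conversion (such as floor) from reals
  to naturals; 0 and 1 are the only real constants; the program text does not
  depend on the input. *)

Inductive nexp : Type :=
| NConst of nat
| NGet of nat & nexp            (* array name, index *)
| NAdd of nexp & nexp
| NSub of nexp & nexp.          (* truncated *)

Inductive rexp : Type :=
| RZero
| ROne
| RGet of nat & nexp
| RAdd of rexp & rexp
| RSub of rexp & rexp
| RMul of rexp & rexp
| RDiv of rexp & rexp.          (* x / 0 = 0, as in MathComp *)

Inductive bexp : Type :=
| NLe of nexp & nexp
| RLe of rexp & rexp
| BNot of bexp
| BAnd of bexp & bexp.

Inductive cmd : Type :=
| Skip
| NSet of nat & nexp & nexp     (* array name, index, value *)
| RSet of nat & nexp & rexp
| Seq of cmd & cmd
| If of bexp & cmd & cmd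
| While of bexp & cmd.

Record state (R : realType) : Type := State {
  nmem : nat -> nat -> nat;
  rmem : nat -> nat -> R
}.

Definition update (T : Type) (m : nat -> nat -> T) (A i : nat) (v : T) :
    nat -> nat -> T :=
  fun B j => if (B == A) && (j == i) then v else m B j.

Fixpoint neval (R : realType) (st : state R) (e : nexp) : nat :=
  match e with
  | NConst m => m
  | NGet A i => nmem st A (neval st i)
  | NAdd e1 e2 => (neval st e1 + neval st e2)%N
  | NSub e1 e2 => (neval st e1 - neval st e2)%N
  end.

Fixpoint reval (R : realType) (st : state R) (e : rexp) : R :=
  match e with
  | RZero => 0
  | ROne => 1
  | RGet A i => rmem st A (neval st i)
  | RAdd e1 e2 => reval st e1 + reval st e2
  | RSub e1 e2 => reval st e1 - reval st e2
  | RMul e1 e2 => reval st e1 * reval st e2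
  | RDiv e1 e2 => reval st e1 / reval st e2
  end.

Fixpoint beval (R : realType) (st : state R) (e : bexp) : bool :=
  match e with
  | NLe e1 e2 => (neval st e1 <= neval st e2)%N
  | RLe e1 e2 => reval st e1 <= reval st e2
  | BNot e1 => ~~ beval st e1
  | BAnd e1 e2 => beval st e1 && beval st e2
  end.

(** Every constant, memory access, arithmetic operation, comparison and
  Boolean connective costs one time unit, as does every command, and every
  evaluation of a branching or loop condition. *)

Fixpoint ncost (e : nexp) : nat :=
  match e with
  | NConst _ => 1
  | NGet _ i => (ncost i).+1
  | NAdd e1 e2 | NSub e1 e2 => (ncost e1 + ncost e2).+1
  end.

Fixpoint rcost (e : rexp) : nat :=
  match e with
  | RZero | ROne => 1
  | RGet _ i => (ncost i).+1
  | RAdd e1 e2 | RSub e1 e2 | RMul e1 e2 | RDiv e1 e2 =>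
      (rcost e1 + rcost e2).+1
  end.

Fixpoint bcost (e : bexp) : nat :=
  match e with
  | NLe e1 e2 => (ncost e1 + ncost e2).+1
  | RLe e1 e2 => (rcost e1 + rcost e2).+1
  | BNot e1 => (bcost e1).+1
  | BAnd e1 e2 => (bcost e1 + bcost e2).+1
  end.

(** [exec P st st' t]: started in [st], the program [P] halts in [st'] after
  exactly [t] time units. *)

Inductive exec (R : realType) : cmd -> state R -> state R -> nat -> Prop :=
| ExecSkip st : exec Skip st st 1
| ExecNSet A i e st :
    exec (NSet A i e) st
      (State (update (nmem st) A (neval st i) (neval st e)) (rmem st))
      (ncost i + ncost e).+1
| ExecRSet A i e st :
    exec (RSet A i e) st
      (State (nmem st) (update (rmem st) A (neval st i) (reval st e)))
      (ncost i + rcost e).+1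
| ExecSeq P Q st1 st2 st3 t u :
    exec P st1 st2 t -> exec Q st2 st3 u -> exec (Seq P Q) st1 st3 (t + u)
| ExecIf b P Q st st' t :
    exec (if beval st b then P else Q) st st' t ->
    exec (If b P Q) st st' (bcost b + t).+1
| ExecWhileStop b P st :
    ~~ beval st b -> exec (While b P) st st (bcost b).+1
| ExecWhileStep b P st1 st2 st3 t u :
    beval st1 b -> exec P st1 st2 t -> exec (While b P) st2 st3 u ->
    exec (While b P) st1 st3 (bcost b + t + u).+1.

Lemma exec_deterministic (R : realType) (P : cmd) (st st1 st2 : state R)
    (t1 t2 : nat) :
  exec P st st1 t1 -> exec P st st2 t2 -> st1 = st2 /\ t1 = t2.
Proof.
move=> H; elim: H st2 t2 => {P st st1 t1}; intros;
  match goal with H : exec _ _ ?s ?t |- _ = ?s /\ _ = ?t =>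
    inversion H; clear H; subst => //
  end;
  repeat match goal with
  | H1 : is_true (beval ?s ?b), H2 : is_true (~~ beval ?s ?b) |- _ =>
      by rewrite H1 in H2
  | IH : forall s t, exec ?P ?s0 s t -> _, E : exec ?P ?s0 _ _ |- _ =>
      case: (IH _ _ E) => ? ?; clear IH E; subst
  end; by [].
Qed.

(** Natural array 0 holds [n] and [k] in cells 0 and 1; real array 0 holds [c]
  in cell 0; real arrays 1 and 2 hold the coefficients [a i] and [b i] of
  [f_i(x) = a_i x + b_i] in cells [i < n].  Every other cell is 0. *)
Definition input_state (R : realType) (n k : nat) (a b : 'I_n -> R) (c : R) :
    state R :=
  State
    (fun A i => if A == 0%N then nth 0%N [:: n; k] i else 0%N)
    (fun A i => match A with
                | 0%N => if i == 0%N then c else 0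
                | 1%N => oapp a 0 (insub i)
                | 2%N => oapp b 0 (insub i)
                | _ => 0
                end).

(** The permutation is left in cells [i < n] of natural array 1. *)
Definition outputs (R : realType) (n : nat) (st : state R) (s : 'S_n) : Prop :=
  forall i : 'I_n, nmem st 1 i = s i.

(* Main.v *)
Require Import Defs.
From mathcomp Require Import all_boot all_order all_algebra all_fingroup reals.
From mathcomp Require Import ring lra zify.

(** Write v_f = (1 - a, b) for f(x) = a x + b.  Exchanging two consecutive blocks F, G of a composition
  changes its value by a nonnegative multiple of det (v_F, v_G), and v of a composition is a conic
  combination of the v of its members.  Hence, when all slopes are positive, an exchange argument
  shows that a fixed set of functions is optimally composed in counterclockwise order of the v_f,
  starting from a suitable one; zero slopes are reached by a perturbation f + e (id - f), which keeps
  the directions of the v_f.  It therefore suffices to sort all functions by angle once and, for each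
  of the n rotations of the sorted sequence, to find the best subsequence of length k, which dynamic
  programming does in O(k n) time because the functions are monotone. *)

Set Implicit Arguments.
Unset Strict Implicit.
Unset Printing Implicit Defensive.

Import Order.TTheory GRing.Theory Num.Theory.
Local Open Scope ring_scope.

(** * Exchange of blocks *)

(** The obstacle is that the sign of the determinant is not transitive around a full turn, so
    pairwise exchanges alone define no global order. The circle is therefore cut at [i0], the first
    function other than the identity in some optimal composition. The rest fall into those ahead of
    [i0], at an angle in [0, pi), and those behind. Inside each half the sign of the determinant
    agrees with the angle, so sorting a half is easy; the substance is [gather], which brings all
    functions ahead of [i0] before all those behind it without loss. As [i0] is unknown, every
    rotation is tried; an optimal set in rotated order is a subsequence of the rotated full order.
    Positive slopes are essential here: a zero slope erases all that precedes it, and optimality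
    then tells nothing about determinants. The perturbation needs no limit: if every rotation were
    strictly worse, all of these finitely many strict inequalities would persist for one small e,
    against the case of positive slopes. The unchanged directions make one sorted sequence serve
    every e. *)

Section Affine.
Variables (R : realType) (a b : nat -> R).

Definition ev (s : seq nat) (x : R) : R := foldl (fun x i => a i * x + b i) x s.
Definition slope (s : seq nat) : R := \prod_(i <- s) a i.
(* [(al s, be s)] is the vector v of the whole composition. *)
Definition al (s : seq nat) : R := 1 - slope s.
Definition be (s : seq nat) : R := ev s 0.
Definition cross (s t : seq nat) : R := al s * be t - be s * al t.

Lemma ev_cat s t x : ev (s ++ t) x = ev t (ev s x).
Proof. by rewrite /ev foldl_cat. Qed.

Lemma slope_cat s t : slope (s ++ t) = slope s * slope t.
Proof. by rewrite /slope big_cat. Qed.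

Lemma slope1 i : slope [:: i] = a i.
Proof. by rewrite /slope big_seq1. Qed.

Lemma ev_affine s x : ev s x = slope s * x + be s.
Proof.
rewrite /be; elim: s x => [|i s IH] x; first by rewrite /slope big_nil /=; ring.
rewrite /slope big_cons -/(slope s) /= !(IH (_ + _)); ring.
Qed.

Lemma be_cat s t : be (s ++ t) = slope t * be s + be t.
Proof. by rewrite /be ev_cat ev_affine. Qed.

Lemma al_cat s t : al (s ++ t) = al t + slope t * al s.
Proof. rewrite /al slope_cat; ring. Qed.

Lemma be1 i : be [:: i] = b i.
Proof. by rewrite /be /ev /= mulr0 add0r. Qed.

Lemma ev_swap X F G Y x :
  ev (X ++ F ++ G ++ Y) x - ev (X ++ G ++ F ++ Y) x = slope Y * cross F G.
Proof. rewrite !ev_affine !be_cat !slope_cat /cross /al; ring. Qed.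

Lemma cross_catl s t u : cross (s ++ t) u = cross t u + slope t * cross s u.
Proof. rewrite /cross al_cat be_cat; ring. Qed.

Lemma cross_nil u : cross [::] u = 0.
Proof. rewrite /cross /al /be /slope big_nil /=; ring. Qed.

Hypothesis a_gt0 : forall i, 0 < a i.

Lemma slope_gt0 s : 0 < slope s.
Proof. by rewrite /slope; apply: prodr_gt0. Qed.

Lemma cross_le0 s x : (forall i, i \in s -> cross [:: i] [:: x] <= 0) ->
  cross s [:: x] <= 0.
Proof.
elim/last_ind: s => [|s i IH] H; first by rewrite cross_nil.
rewrite -cats1 cross_catl; have h1 := H i; rewrite mem_rcons mem_head in h1.
have := slope_gt0 [:: i]; have := h1 isT.
have : cross s [:: x] <= 0 by apply: IH => j js; apply: H; rewrite mem_rcons inE js orbT.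
nra.
Qed.

Lemma ev_le_swap X F G Y x : cross F G <= 0 ->
  ev (X ++ F ++ G ++ Y) x <= ev (X ++ G ++ F ++ Y) x.
Proof. by move=> h; have := ev_swap X F G Y x; have := slope_gt0 Y; nra. Qed.

Lemma ev_sort t X s Y x :
  pairwise (fun i j => 0 <= cross [:: i] [:: j]) t -> perm_eq s t ->
  ev (X ++ s ++ Y) x <= ev (X ++ t ++ Y) x.
Proof.
elim: t X s => [|i t IH] X s; first by move=> _ /perm_nilP ->.
rewrite pairwise_cons => /andP[/allP it pt] st.
have i_s : i \in s by rewrite (perm_mem st) mem_head.
case/splitPr: i_s st => s1 s2 st; have {}st : perm_eq (s1 ++ s2) t.
  by rewrite -(perm_cons i) -(perm_catCA s1 [:: i] s2).
have {}IH := IH (rcons X i) _ pt st.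
(* Insertion: the head [i] of the sorted list jumps over the whole block [s1], whose members all lie
   counterclockwise of [i]. *)
rewrite -!catA -cat1s; apply: (@le_trans _ _ (ev (X ++ [:: i] ++ s1 ++ s2 ++ Y) x)).
  rewrite -!catA; apply: ev_le_swap; apply: cross_le0 => j js.
  have /it : j \in t by rewrite -(perm_mem st) mem_cat js.
  by rewrite /cross; lra.
by move: IH; rewrite -!cats1 -!catA.
Qed.

Definition optimal (x : R) (s : seq nat) :=
  forall s', perm_eq s' s -> ev s' x <= ev s x.

(** The slope of the tail [Y] is positive, so the sign of the loss in an exchange is that of
    [cross F G]. *)
Lemma optimal_cross x X F G Y : optimal x (X ++ F ++ G ++ Y) -> 0 <= cross F G.
Proof.
move=> /(_ (X ++ G ++ F ++ Y)); rewrite perm_cat2l !catA perm_cat2r perm_catC perm_refl -!catA.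
by move=> /(_ isT); have := ev_swap X F G Y x; have := slope_gt0 Y; nra.
Qed.

Lemma optimal_perm x s t : perm_eq s t -> ev t x <= ev s x -> optimal x t -> optimal x s.
Proof. by move=> st ts ot u us; apply: le_trans ts; apply: ot; apply: perm_trans st. Qed.

Lemma optimal_exists x s : exists2 t, perm_eq t s & optimal x t.
Proof.
suff [t ts ot] : exists2 t, t \in permutations s &
    forall u, u \in permutations s -> ev u x <= ev t x.
  exists t; first by rewrite -mem_permutations.
  by move=> u ut; apply: ot; rewrite mem_permutations (perm_trans ut) // -mem_permutations.
have : permutations s != [::].
  by apply/eqP => h; have := mem_permutations s s; rewrite h perm_refl.
elim: (permutations s) => // u [|v l] IH _.
  by exists u; rewrite ?mem_head // => w; rewrite inE => /eqP ->.
have [t tl ot] := IH isT.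
have [ut|tu] := leP (ev u x) (ev t x).
  exists t; first by rewrite inE tl orbT.
  by move=> w; rewrite inE => /predU1P[->//|/ot].
exists u; first by rewrite mem_head.
by move=> w; rewrite inE => /predU1P[->//|/ot /le_trans]; apply; apply: ltW.
Qed.

End Affine.

(** * Bringing the functions ahead of the first one to the front *)

Section Gather.
Variables (R : realType) (a b : nat -> R) (ex ey lam : nat -> R).
Hypothesis a_gt0 : forall i, 0 < a i.
Hypothesis lam_ge0 : forall i, 0 <= lam i.
Hypothesis al_dir : forall i, 1 - a i = lam i * ex i.
Hypothesis be_dir : forall i, b i = lam i * ey i.

Definition dcross (i j : nat) : R := ex i * ey j - ey i * ex j.

Lemma cross_dir i j : cross a b [:: i] [:: j] = lam i * lam j * dcross i j.
Proof. rewrite /cross /al !slope1 !be1 /dcross !al_dir !be_dir; ring. Qed.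

Variables (i0 : nat) (D : pred nat) (x : R).
Hypothesis lam_i0 : 0 < lam i0.
Hypothesis norm_gt0 : 0 < ex i0 ^+ 2 + ey i0 ^+ 2.
Hypothesis D_ge0 : forall i, D i -> 0 <= dcross i0 i.
Hypothesis ND_lt0 : forall i, ~~ D i ->
  dcross i0 i < 0 \/ dcross i0 i = 0 /\ ex i0 * ex i + ey i0 * ey i <= 0.

(** Up to scaling, [y] and [d] are the coordinates of the vector of a block across and along the
    direction of [i0]. *)
Let y (s : seq nat) : R := ex i0 * be a b s - ey i0 * al a s.
Let d (s : seq nat) : R := ex i0 * al a s + ey i0 * be a b s.

Lemma cross_y s : cross a b [:: i0] s = lam i0 * y s.
Proof. rewrite /cross /y /al slope1 be1 al_dir be_dir; ring. Qed.

Lemma y1 i : y [:: i] = lam i * dcross i0 i.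
Proof. rewrite /y /al slope1 be1 al_dir be_dir /dcross; ring. Qed.

Lemma d1 i : d [:: i] = lam i * (ex i0 * ex i + ey i0 * ey i).
Proof. rewrite /d /al slope1 be1 al_dir be_dir; ring. Qed.

Lemma y_cat s t : y (s ++ t) = y t + slope a t * y s.
Proof. rewrite /y be_cat al_cat; ring. Qed.

Lemma d_cat s t : d (s ++ t) = d t + slope a t * d s.
Proof. rewrite /d be_cat al_cat; ring. Qed.

(** The region behind [i0], an open half-plane together with the ray opposite to [i0] and the
    origin, is a convex cone, and the vector of a block is a conic combination of those of its
    members. *)
Lemma y_ND F : all (predC D) F -> y F < 0 \/ y F = 0 /\ d F <= 0.
Proof.
elim/last_ind: F => [_|F i IH].
  by right; rewrite /y /d /al /be /slope !big_nil /=; split; lra.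
rewrite all_rcons => /andP[iD FD]; rewrite -cats1 y_cat d_cat y1 d1.
have := slope_gt0 a_gt0 [:: i]; have := lam_ge0 i.
have := ND_lt0 iD; have := IH FD.
set u := dcross _ _; set v := _ + _; set w := slope _ _.
move=> [yF|[-> dF]] [u0|[-> v0]] l0 w0.
- by left; nra.
- by left; nra.
- have [->|ln0] := eqVneq (lam i) 0; first by right; split; nra.
  have : 0 < lam i by rewrite lt_def ln0.
  by left; nra.
- by right; split; nra.
Qed.

Lemma norm_cross F g :
  (ex i0 ^+ 2 + ey i0 ^+ 2) * cross a b F [:: g] = d F * y [:: g] - y F * d [:: g].
Proof. rewrite /cross /y /d; ring. Qed.

(* For [y F < 0] and [g] with [0 <= y [:: g]], optimality makes the right-hand side nonnegative, so that
  [g] may be moved in front of the whole block [P ++ F]. *)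
Lemma y_cross P F g :
  y F * cross a b (P ++ F) [:: g] =
  cross a b F [:: g] * y (P ++ F) + slope a F * cross a b P F * y [:: g].
Proof. rewrite cross_catl y_cat /cross /y; ring. Qed.

Lemma optimal_y F G : optimal a b x (i0 :: F ++ G) -> 0 <= y F.
Proof.
by move=> /(optimal_cross a_gt0 (X := [::]) (F := [:: i0])); rewrite cross_y pmulr_rge0.
Qed.

(** Induction on the part [Y] not yet distributed. The sequence stays optimal after each move, so
    that [optimal_cross] keeps supplying signs for the next one. *)
Lemma gather Y P F : all D P -> all (predC D) F ->
    optimal a b x (i0 :: P ++ F ++ Y) ->
  exists P' F', [/\ all D P', all (predC D) F', perm_eq (P' ++ F') (P ++ F ++ Y)
    & ev a b (i0 :: P ++ F ++ Y) x <= ev a b (i0 :: P' ++ F') x].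
Proof.
elim: Y P F => [|g Y IH] P F DP DF opt; first by exists P, F; rewrite cats0.
have [Dg|Dg] := boolP (D g); last first.
  have [||P' [F' []]] := IH P (rcons F g) DP; rewrite -?cats1 ?all_cat ?DF /= ?Dg -?catA //.
  by exists P', F'.
have step P' F' : all D P' -> all (predC D) F' ->
    perm_eq (P' ++ F' ++ Y) (P ++ F ++ g :: Y) ->
    ev a b (i0 :: P ++ F ++ g :: Y) x <= ev a b (i0 :: P' ++ F' ++ Y) x ->
  exists P' F', [/\ all D P', all (predC D) F', perm_eq (P' ++ F') (P ++ F ++ g :: Y)
    & ev a b (i0 :: P ++ F ++ g :: Y) x <= ev a b (i0 :: P' ++ F') x].
  move=> DP' DF' p le; have [|P'' [F'' [? ? p' le']]] := IH P' F' DP' DF'.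
    by apply: (optimal_perm _ le opt); rewrite perm_cons.
  by exists P'', F''; split=> //; [apply: perm_trans p | apply: le_trans le'].
have yg : 0 <= y [:: g] by rewrite y1 mulr_ge0 // D_ge0.
(* If [F] points strictly behind, [y_cross] shows that [g] may overtake [P ++ F]. Otherwise the
   vector of [F] is opposite to [i0] or zero, [norm_cross] gives [cross F [:: g] <= 0], and [g]
   overtakes [F] only. *)
have [yF|[yF dF]] := y_ND DF.
  apply: (step (g :: P) F); rewrite /= ?Dg //.
    by rewrite -[g :: P ++ _]cat1s -[g :: Y]cat1s !catA perm_cat2r -catA perm_catC.
  have := ev_le_swap a_gt0 [:: i0] (F := P ++ F) (G := [:: g]) Y x.
  rewrite -!catA; apply.
  have yPF : 0 <= y (P ++ F) by apply: (optimal_y (G := g :: Y)); rewrite -catA.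
  have cFg : 0 <= cross a b F [:: g].
    by apply: (optimal_cross a_gt0 (X := i0 :: P) (Y := Y) (x := x)).
  have cPF : 0 <= cross a b P F.
    by apply: (optimal_cross a_gt0 (X := [:: i0]) (Y := g :: Y) (x := x)).
  have := y_cross P F g; have := mulr_ge0 cFg yPF.
  have := mulr_ge0 (mulr_ge0 (ltW (slope_gt0 a_gt0 F)) cPF) yg; nra.
apply: (step (rcons P g) F); rewrite ?all_rcons ?Dg //.
  rewrite -cats1 -catA perm_cat2l -[g :: Y]cat1s !catA perm_cat2r.
  by rewrite perm_catC.
have := ev_le_swap a_gt0 (i0 :: P) (F := F) (G := [:: g]) Y x.
rewrite -cats1 -!catA; apply.
have := norm_cross F g; rewrite yF mul0r subr0; have := norm_gt0; nra.
Qed.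

End Gather.

(** * The angular order and its rotations *)

Lemma pairwise_split (T : eqType) (r : rel T) (p : pred T) (s : seq T) :
  (forall i j, r i j -> p j -> p i) -> pairwise r s ->
  s = filter p s ++ filter (predC p) s.
Proof.
move=> rp; elim: s => //= i s IH /andP[/allP ri /IH {}IH].
case: ifPn => [pi|npi]; first by rewrite [in LHS]IH.
have np j : j \in s -> ~~ p j by move=> /ri ij; apply: contra npi; apply: rp.
rewrite (eq_in_filter (a2 := pred0)) ?filter_pred0 /=; last by move=> j /np /negPf.
by rewrite (eq_in_filter (a2 := predT)) ?filter_predT // => j /np.
Qed.

Section Order.
Variables (R : realType) (a b : nat -> R).

(* The classes list the directions (1 - a, b) counterclockwise from (0, -1), excluded: right half-plane,
  (0, 1), left half-plane, (0, -1).  The identity, whose vector vanishes, is given the direction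
  (0, 1).  Inside a half-plane the angle increases with the fixed point b / (1 - a), which is b / 0 = 0
  in the classes 1 and 3. *)
Definition cls (i : nat) : nat :=
  if 1 <= a i then if a i <= 1 then if 0 <= b i then 1 else 3 else 2 else 0.
Definition wt (i : nat) : R := b i / (1 - a i).

Definition key_lt (i j : nat) : bool :=
  (cls i < cls j)%N || (cls i == cls j) && (wt i < wt j).

Definition dirx (i : nat) : R :=
  match cls i with 0 => 1 | 2 => -1 | _ => 0 end.
Definition diry (i : nat) : R :=
  match cls i with 0 => wt i | 1 => 1 | 2 => - wt i | _ => -1 end.
Definition mag (i : nat) : R :=
  match cls i with 0 => 1 - a i | 2 => a i - 1 | _ => `|b i| end.

Variant cls_spec i : nat -> R -> R -> R -> R -> Prop :=
| Cls0 of a i < 1 : cls_spec i 0 (wt i) 1 (wt i) (1 - a i)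
| Cls1 of a i = 1 /\ 0 <= b i : cls_spec i 1 0 0 1 (b i)
| Cls2 of 1 < a i : cls_spec i 2 (wt i) (-1) (- wt i) (a i - 1)
| Cls3 of a i = 1 /\ b i < 0 : cls_spec i 3 0 0 (-1) (- b i).

Lemma clsP i : cls_spec i (cls i) (wt i) (dirx i) (diry i) (mag i).
Proof.
rewrite /dirx /diry /mag /cls; case: (ltgtP (a i) 1) => [h|h|h]; [by constructor..|].
by case: ger0P => hb; rewrite /wt h subrr invr0 mulr0; constructor.
Qed.

Lemma mag_ge0 i : 0 <= mag i.
Proof. by case: (clsP i) => [|[]||[]]; lra. Qed.

Lemma al_mag i : 1 - a i = mag i * dirx i.
Proof. by case: (clsP i) => [|[]||[]]; lra. Qed.

Lemma be_mag i : b i = mag i * diry i.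
Proof.
rewrite /wt /dirx /diry /mag /cls; case: (ltgtP (a i) 1) => h.
- by rewrite /wt mulrCA divff ?mulr1 //; apply/eqP; lra.
- by rewrite /wt mulrN -mulNr opprB mulrCA divff ?mulr1 //; apply/eqP; lra.
- by case: ger0P => hb /=; lra.
Qed.

Lemma dir_norm_gt0 i : 0 < dirx i ^+ 2 + diry i ^+ 2.
Proof. by case: (clsP i) => *; rewrite ?expr2; nra. Qed.

(* The angle from [i0] to [i] lies in [0, pi). *)
Definition ahead (i0 i : nat) : bool :=
  (0 < dcross dirx diry i0 i) || (cls i == cls i0) && (wt i == wt i0).

(** The angular order with its cut moved to [i0]: elements of smaller key than [i0] come last. *)
Definition rot_le (i0 i j : nat) : bool :=
  if key_lt j i0 then ~~ key_lt i i0 || ~~ key_lt j i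
  else ~~ key_lt i i0 && ~~ key_lt j i.

Lemma ahead_ge0 i0 i : ahead i0 i -> 0 <= dcross dirx diry i0 i.
Proof.
rewrite /ahead /dcross; case: (clsP i0) => _; case: (clsP i) => _ /=; rewrite ?eqxx /=; lra.
Qed.

Lemma behind_lt0 i0 i : ~~ ahead i0 i -> dcross dirx diry i0 i < 0 \/
  dcross dirx diry i0 i = 0 /\ dirx i0 * dirx i + diry i0 * diry i <= 0.
Proof.
rewrite /ahead /dcross; case: (clsP i0) => _; case: (clsP i) => _ /=; rewrite ?eqxx //=; try lra;
  rewrite orbF -leNgt le_eqVlt => /orP[/eqP h|]; [right | by left | right | by left];
  split=> //; have := sqr_ge0 (wt i0); rewrite expr2; nra.
Qed.

Lemma rot_le_ahead i0 i j : rot_le i0 i j -> ahead i0 j -> ahead i0 i.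
Proof.
rewrite /rot_le /ahead /key_lt /dcross.
case: (clsP i0) => _ /=; case: (clsP i) => _ /=; case: (clsP j) => _ /=;
  rewrite ?ltxx ?eqxx //=; try lra; by case: ltP; lra.
Qed.

(** Each half covers a half-open half turn, within which a larger angle means a nonnegative
    determinant. *)
Lemma rot_le_cross i0 i j : rot_le i0 i j -> ahead i0 i = ahead i0 j ->
  0 <= dcross dirx diry i j.
Proof.
suff : rot_le i0 i j -> (ahead i0 i /\ ahead i0 j) \/ (~~ ahead i0 i /\ ~~ ahead i0 j) ->
    0 <= dcross dirx diry i j.
  by move=> H /H {}H; case: (ahead i0 i) (ahead i0 j) H => [] [] H // _; apply: H; auto.
rewrite /rot_le /ahead /key_lt /dcross.
case: (clsP i0) => _ /=; case: (clsP i) => _ /=; case: (clsP j) => _ /=;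
  rewrite ?ltxx ?eqxx //=; try lra; by case: ltP; lra.
Qed.

Lemma key_le_lt_trans i j k : ~~ key_lt j i -> key_lt j k -> key_lt i k.
Proof.
rewrite /key_lt; case: (clsP i) => _ /=; case: (clsP j) => _ /=; case: (clsP k) => _ //=; lra.
Qed.

Lemma key_lt_irr i : ~~ key_lt i i.
Proof. by rewrite /key_lt ltnn ltxx andbF. Qed.

Lemma rotation_from (ord : seq nat) i0 :
  pairwise (fun i j => ~~ key_lt j i) ord -> i0 \in ord ->
  exists2 r, (r < size ord)%N & pairwise (rot_le i0) (rot r ord).
Proof.
move=> ord_le i0_ord; pose p := key_lt ^~ i0.
have ordE : ord = filter p ord ++ filter (predC p) ord.
  by apply: pairwise_split ord_le => i j; apply: key_le_lt_trans.
(* The rotation starts at the first element whose key is not below that of [i0]; with ties this need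
   not be [i0] itself. *)
exists (size (filter p ord)).
  rewrite size_filter -(count_predC p ord) -[X in (X < _)%N]addn0 ltn_add2l -has_count.
  by apply/hasP; exists i0 => //=; apply: key_lt_irr.
have -> : rot (size (filter p ord)) ord = filter (predC p) ord ++ filter p ord.
  by rewrite [X in rot _ X]ordE rot_size_cat.
rewrite pairwise_cat; apply/and3P; split.
- apply/allrelP => i j; rewrite !mem_filter /= /rot_le => /andP[pi _] /andP[pj _].
  by rewrite -/(p i) -/(p j) pi pj.
- apply: (sub_in_pairwise (P := predC p) (r := fun i j => ~~ key_lt j i)).
  + by move=> i j; rewrite !inE /rot_le -/(p i) -/(p j) => pi pj; rewrite (negPf pj) pi.
  + exact: filter_all.
  + exact: pairwise_filter.
- apply: (sub_in_pairwise (P := p) (r := fun i j => ~~ key_lt j i)).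
  + by move=> i j pi pj le_ij; rewrite /rot_le (pi : key_lt i i0) (pj : key_lt j i0) le_ij.
  + exact: filter_all.
  + exact: pairwise_filter.
Qed.
End Order.

(** The functions composed are given by [a'] and [b'], while the order and the directions come from
    [a] and [b]; this separation lets [ord] stay fixed under perturbation. *)
Lemma rotation_pos (R : realType) (a b a' b' lam : nat -> R) (ord s : seq nat) (x : R) :
  (forall i, 0 < a' i) -> (forall i, 0 <= lam i) ->
  (forall i, 1 - a' i = lam i * dirx a b i) -> (forall i, b' i = lam i * diry a b i) ->
  pairwise (fun i j => ~~ key_lt a b j i) ord -> uniq ord -> (0 < size ord)%N ->
  uniq s -> {subset s <= ord} ->
  exists2 r, (r < size ord)%N &
    ev a' b' s x <= ev a' b' ([seq i <- rot r ord | i \in s]) x.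
Proof.
move=> a_gt0 lam_ge0 al_dir be_dir ord_le ord_uniq ord_gt0 s_uniq s_ord.
have s_perm r : perm_eq s ([seq i <- rot r ord | i \in s]).
  apply: uniq_perm => //; first by rewrite filter_uniq ?rot_uniq.
  by move=> i; rewrite mem_filter mem_rot; have [/s_ord ->|] := boolP (i \in s).
have ev_le t X u Y := @ev_sort _ _ b' a_gt0 t X u Y x.
(* If no member of [s] has a positive factor, all of them are the identity and every order gives the
   same value. *)
have [nid|id] := boolP (has (fun i => 0 < lam i) s); last first.
  exists 0%N => //; have := @ev_le ([seq i <- rot 0 ord | i \in s]) [::] s [::].
  rewrite !cats0 /=; apply=> //; apply: (sub_in_pairwise (P := fun i => i \in s) (r := fun _ _ => true)).
  - move=> i j /(hasPn id) si _ _; rewrite (cross_dir al_dir be_dir).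
    by rewrite (_ : lam i = 0) ?mul0r //; apply/le_anti; rewrite lam_ge0 leNgt si.
  - exact: filter_all.
  - by elim: (filter _ _) => //= i l ->; rewrite andbT; apply/allP.
have [t ts opt_t] := optimal_exists a' b' x s.
move: nid; rewrite -(perm_has _ ts) => nid.
(* A vanishing vector at the front would make [cross_y] empty, so [i0] is the first function with
   [0 < lam i0]; the identities [z] in front of it move behind it at no loss. *)
case/split_find: nid ts opt_t => i0 z t' lam_i0 /hasPn z0; rewrite -cats1 -catA /= => ts opt_t.
have zt_perm : perm_eq (i0 :: z ++ t') (z ++ i0 :: t').
  by rewrite perm_sym -cat1s perm_catCA.
have zt_le : ev a' b' (z ++ i0 :: t') x <= ev a' b' (i0 :: z ++ t') x.
  have := @ev_le_swap _ a' b' a_gt0 [::] z [:: i0] t' x; apply; apply: cross_le0 => // i iz.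
  rewrite (cross_dir al_dir be_dir) (_ : lam i = 0) ?mul0r //.
  by apply/le_anti; rewrite lam_ge0 leNgt z0.
have opt := optimal_perm zt_perm zt_le opt_t.
pose D := ahead a b i0.
have [P [F [DP DF PF_perm PF_le]]] := @gather _ _ _ _ _ _ a_gt0 lam_ge0 al_dir be_dir i0 D x
  lam_i0 (dir_norm_gt0 a b i0) (@ahead_ge0 _ a b i0) (@behind_lt0 _ a b i0) (z ++ t') [::] [::]
  isT isT opt.
have i0_s : i0 \in s by rewrite -(perm_mem ts) mem_cat mem_head orbT.
have [r r_lt r_le] := rotation_from ord_le (s_ord _ i0_s).
exists r => //; set T := filter _ _.
have T_le : pairwise (rot_le a b i0) T by apply: pairwise_filter.
have TE : T = filter D T ++ filter (predC D) T.
  by apply: pairwise_split T_le => i j; apply: rot_le_ahead.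
have PF_T : perm_eq (i0 :: P ++ F) T.
  apply: perm_trans (s_perm r); apply: perm_trans ts; apply: perm_trans zt_perm.
  by rewrite perm_cons.
have D_i0 : D i0 by rewrite /D /ahead !eqxx orbT.
have P_T : perm_eq (i0 :: P) (filter D T).
  have := perm_filter D PF_T; rewrite /= D_i0 filter_cat (all_filterP DP).
  by rewrite (_ : filter D F = [::]) ?cats0 //; apply/eqP; rewrite -[_ == _]negbK -has_filter -all_predC.
have F_T : perm_eq F (filter (predC D) T).
  have := perm_filter (predC D) PF_T; rewrite /= D_i0 filter_cat (all_filterP DF).
  rewrite (_ : filter (predC D) P = [::]) //; apply/eqP.
  by rewrite -[_ == _]negbK -has_filter has_predC negbK.
(* It remains to sort each half separately into the order of the rotation. *)
have cross_ge0 (p : pred nat) : (forall i j, p i -> p j -> D i = D j) ->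
    pairwise (fun i j => 0 <= cross a' b' [:: i] [:: j]) (filter p T).
  move=> Dp; apply: (sub_in_pairwise (P := p) (r := rot_le a b i0)).
  - move=> i j pi pj ij; rewrite (cross_dir al_dir be_dir).
    by rewrite !mulr_ge0 // (rot_le_cross ij) // -!/(D _) (Dp i j).
  - exact: filter_all.
  - exact: pairwise_filter.
apply: (@le_trans _ _ (ev a' b' (z ++ i0 :: t') x)); first by apply: opt_t; rewrite perm_sym.
apply: (le_trans zt_le); apply: (le_trans PF_le); rewrite TE.
apply: (@le_trans _ _ (ev a' b' (filter D T ++ F) x)).
  by apply: (ev_le _ [::] _ F _ P_T); apply: cross_ge0 => i j -> ->.
have := ev_le (filter (predC D) T) (filter D T) F [::]; rewrite !cats0; apply=> //.
by apply: cross_ge0 => i j /negPf -> /negPf ->.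
Qed.

(** * Zero slopes *)

Section Perturbation.
Variables (R : realType) (a b : nat -> R).
Hypothesis a_ge0 : forall i, 0 <= a i.

(* The convex combination of [f_i] with the identity: it has positive slope, and its direction
  (1 - a, b) is a positive multiple of that of [f_i]. *)
Definition pert_a (e : R) (i : nat) : R := (1 - e) * a i + e.
Definition pert_b (e : R) (i : nat) : R := (1 - e) * b i.

(** A Lipschitz bound at e = 0 in place of continuity; it yields an explicit threshold in
    [rotation]. *)
Lemma ev_pert s x : exists2 M, 0 <= M & forall e, 0 <= e <= 1 ->
  `|ev (pert_a e) (pert_b e) s x - ev a b s x| <= M * e.
Proof.
elim/last_ind: s => [|s i [M M0 IH]]; first by exists 0 => // e _; rewrite subrr normr0 mul0r.
pose v := ev a b s x; pose K := (1 + a i) * (`|v| + M) + `|b i|.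
have ai := a_ge0 i; have v0 := normr_ge0 v; have bi := normr_ge0 (b i).
exists (a i * M + K) => [|e /andP[e0 e1]]; first by rewrite /K; nra.
rewrite -cats1 !ev_cat -/v /ev /= -/(ev (pert_a e) (pert_b e) s x).
set u := ev _ _ s x; rewrite /pert_a /pert_b.
have uv : `|u - v| <= M * e by apply: IH; rewrite e0.
have u_le : `|u| <= `|v| + M.
  by rewrite -[u](subrK v); apply: (le_trans (ler_normD _ _)); nra.
rewrite (_ : _ - _ = a i * (u - v) + e * (u - a i * u - b i)); last by ring.
apply: (le_trans (ler_normD _ _)); rewrite !normrM (ger0_norm ai) (ger0_norm e0) mulrDl lerD //.
  by rewrite -mulrA ler_wpM2l.
rewrite mulrC ler_wpM2r //; apply: (le_trans (ler_normB _ _)); rewrite lerD2r.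
apply: (le_trans (ler_normB _ _)); rewrite normrM (ger0_norm ai); nra.
Qed.

(** Each condition is assumed on a whole interval above 0, so that the minimum of the thresholds
    serves all of them. *)
Lemma common_small (m : nat) (Q : nat -> R -> Prop) :
  (forall r, (r < m)%N -> exists2 e, 0 < e & forall e', 0 < e' <= e -> Q r e') ->
  exists2 e, 0 < e <= 1 & forall r, (r < m)%N -> Q r e.
Proof.
move=> H; suff [e e01 He] : exists2 e, 0 < e <= 1 &
    forall r, (r < m)%N -> forall e', 0 < e' <= e -> Q r e'.
  by exists e => // r /He; apply; case/andP: e01 => ->; rewrite lexx.
elim: m H => [|m IH] H; first by exists 1; rewrite ?ltr01 ?lexx.
have [r rm|e /andP[e0 e1] He] := IH; first by apply: H; apply: ltnW.
have [e' e'0 He'] := H m (ltnSn m).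
exists (Num.min e e'); first by rewrite lt_min e0 e'0 ge_min e1.
move=> r; rewrite ltnS leq_eqVlt => /predU1P[->|rm] d; rewrite le_min => /and3P[d0 de de'].
  by apply: He'; rewrite d0.
by apply: (He r rm); rewrite d0.
Qed.

Theorem rotation (ord s : seq nat) (x : R) :
  pairwise (fun i j => ~~ key_lt a b j i) ord -> uniq ord -> (0 < size ord)%N ->
  uniq s -> {subset s <= ord} ->
  exists2 r, (r < size ord)%N &
    ev a b s x <= ev a b [seq i <- rot r ord | i \in s] x.
Proof.
move=> ord_le ord_uniq ord_gt0 s_uniq s_ord.
have [/existsP[r r_le]|/existsPn no_r] := boolP [exists r : 'I_(size ord),
  ev a b s x <= ev a b [seq i <- rot r ord | i \in s] x]; first by exists r.
have [|e /andP[e0 e1] He] := @common_small (size ord) (fun r e =>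
  e < 1 /\ ev (pert_a e) (pert_b e) [seq i <- rot r ord | i \in s] x
    < ev (pert_a e) (pert_b e) s x).
  move=> r r_lt; have := no_r (Ordinal r_lt); rewrite -ltNge /=; set t := filter _ _ => t_lt.
  have [M M0 HM] := ev_pert s x; have [M' M'0 HM'] := ev_pert t x.
  pose K := M + M' + 2; pose g := ev a b s x - ev a b t x.
  have K0 : 1 < K by rewrite /K; lra.
  have g0 : 0 < g by rewrite subr_gt0.
  (* The gap [g] shrinks by at most [(M + M') * e], which is less than [K * e <= g]; the bound 1 / 2
     keeps e below 1. *)
  exists (Num.min (g / K) (1 / 2)).
    by rewrite lt_min !divr_gt0 // (lt_trans _ K0).
  move=> e; rewrite le_min => /and3P[e0 eg e1]; rewrite ler_pdivlMr in eg; last by lra.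
  split; first by lra.
  have e01 : 0 <= e <= 1 by apply/andP; split; lra.
  have := HM e e01; have := HM' e e01; rewrite !ler_norml => /andP[_ h1] /andP[h2 _].
  move: eg; rewrite /K /g => *; nra.
have [e_lt1 _] := He _ ord_gt0.
have [||||r r_lt] := @rotation_pos R a b (pert_a e) (pert_b e) (fun i => (1 - e) * mag a b i)
  ord s x _ _ _ _ ord_le ord_uniq ord_gt0 s_uniq s_ord.
- by move=> i; rewrite /pert_a; have := a_ge0 i; nra.
- by move=> i; rewrite mulr_ge0 ?mag_ge0 //; lra.
- by move=> i; rewrite -mulrA -al_mag /pert_a; ring.
- by move=> i; rewrite -mulrA -be_mag.
by rewrite leNgt; have [_ ->] := He r r_lt.
Qed.
End Perturbation.

(** * Sorting and dynamic programming *)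

Section Ranking.
Variables (R : realType) (a b : nat -> R).
Let q := cls a b.
Let w := wt a b.

(** The key order with ties broken by index: a strict total order, so that ranks are distinct. *)
Definition before (j i : nat) : bool :=
  (q j < q i)%N || (q j == q i) && ((w j < w i) || (w j == w i) && (j < i)%N).

(* The only connectives of the programming language are negation and conjunction. *)
Lemma before_nested j i : before j i = (q j <= q i)%N &&
  ~~ ((q i <= q j)%N && ~~ ((w j <= w i) && ~~ ((w i <= w j) && (i <= j)%N))).
Proof.
by rewrite /before; case: ltngtP => //= _; case: ltgtP => //= _; case: ltngtP.
Qed.

Lemma before_irr i : before i i = false.
Proof. by rewrite /before !ltnn ltxx !andbF. Qed.

Lemma before_trans : transitive before.
Proof.
move=> j i h; rewrite /before.
case/orP=> [qij|/andP[/eqP-> ij]] /orP[qjh|/andP[/eqP<- jh]]; rewrite ?qij ?qjh //.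
  by rewrite (ltn_trans qij).
rewrite eqxx; apply/orP; right; move: ij jh.
case/orP=> [wij|/andP[/eqP-> ij]] /orP[wjh|/andP[/eqP<- jh]]; rewrite ?wij ?wjh //.
  by rewrite (lt_trans wij).
by rewrite eqxx (ltn_trans ij jh) orbT.
Qed.

Lemma before_total i j : i != j -> before i j || before j i.
Proof. by rewrite /before; case: ltngtP => //= _; case: ltgtP => //= _; case: ltngtP. Qed.

Lemma before_key i j : before i j -> ~~ key_lt a b j i.
Proof. by rewrite /before /key_lt -/q -/w; case: ltngtP => //= _; case: ltgtP. Qed.

Definition before_eq (i j : nat) := (i == j) || before i j.
Definition angular_order (n : nat) : seq nat := sort before_eq (iota 0 n).
Definition rank (n i : nat) : nat := count (before^~ i) (iota 0 n).

Lemma order_perm n : perm_eq (angular_order n) (iota 0 n).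
Proof. by rewrite perm_sort. Qed.

Lemma order_uniq n : uniq (angular_order n).
Proof. by rewrite sort_uniq iota_uniq. Qed.

Lemma size_order n : size (angular_order n) = n.
Proof. by rewrite size_sort size_iota. Qed.

Lemma mem_order n i : (i \in angular_order n) = (i < n)%N.
Proof. by rewrite mem_sort mem_iota. Qed.

Lemma order_pairwise n : pairwise before (angular_order n).
Proof.
have tr : transitive before_eq.
  move=> j i h /predU1P[->//|ij] /predU1P[<-|jh]; first by rewrite /before_eq ij orbT.
  by rewrite /before_eq (before_trans ij jh) orbT.
have : pairwise before_eq (angular_order n).
  rewrite -(sorted_pairwise tr); apply: sort_sorted => i j.
  by rewrite /before_eq; have [->|/before_total] := eqVneq i j.
have := order_uniq n; rewrite uniq_pairwise => u p.
have : pairwise [rel i j | (i != j) && before_eq i j] (angular_order n) by rewrite pairwise_relI u p.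
by apply: sub_pairwise => i j /= /andP[/negPf ij]; rewrite /before_eq ij.
Qed.

(** In the sorted sequence exactly the elements [before] i precede it, so counting them, which is
    how the program sorts in quadratic time, gives its position. *)
Lemma nth_rank n i : (i < n)%N -> nth 0%N (angular_order n) (rank n i) = i.
Proof.
rewrite -mem_order => i_ord; rewrite -[RHS](nth_index 0%N i_ord); congr nth.
rewrite /rank -(seq.permP (order_perm n)); move: (order_pairwise n) i_ord.
elim: (angular_order n) => //= h t IH /andP[/allP ht /IH {}IH]; rewrite inE eq_sym.
have [<-|_ /=] := eqVneq h i; last by move=> it; rewrite ht // IH.
rewrite before_irr => _; apply/eqP; rewrite add0n -leqn0 leqNgt -has_count.
apply/hasPn => j /ht ij; apply: contraFN (before_irr h) => ji.
exact: before_trans ji.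
Qed.

Lemma rank_lt n i : (i < n)%N -> (rank n i < n)%N.
Proof.
move=> ltin; rewrite -[X in (_ < X)%N](size_iota 0 n) /rank -(count_predC (before^~ i)) -[X in (X < _)%N]addn0.
rewrite ltn_add2l -has_count; apply/hasP; exists i; rewrite ?mem_iota //=.
by rewrite before_irr.
Qed.

Lemma rank_nth n m : (m < n)%N -> rank n (nth 0%N (angular_order n) m) = m.
Proof.
move=> mn; have ms : (m < size (angular_order n))%N by rewrite size_order.
have e_n : (nth 0%N (angular_order n) m < n)%N by rewrite -mem_order mem_nth.
apply/eqP; rewrite -(nth_uniq 0%N _ ms (order_uniq n)) ?nth_rank //.
by rewrite size_order rank_lt.
Qed.

Lemma rank_inj n i j : (i < n)%N -> (j < n)%N -> rank n i = rank n j -> i = j.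
Proof. by move=> hi hj e; rewrite -(nth_rank hi) e nth_rank. Qed.
End Ranking.

(** * Best subsequences of prescribed length *)

Section BestSubsequence.
Variables (R : realType) (a b : nat -> R) (c : R).
Hypothesis a_ge0 : forall i, 0 <= a i.

Definition best (l : seq nat) (m : nat) (L : seq nat) : Prop :=
  [/\ size L = m, subseq L l &
      forall L', subseq L' l -> size L' = m -> ev a b L' c <= ev a b L c].

Lemma best0 l : best l 0 [::].
Proof. by split=> //; rewrite ?sub0seq // => L' _ /size0nil ->. Qed.

Lemma subseq_rcons_inv (L l : seq nat) e : subseq L (rcons l e) ->
  subseq L l \/ exists2 L', L = rcons L' e & subseq L' l.
Proof.
case/lastP: L => [|L x]; first by left; apply: sub0seq.
rewrite -subseq_rev !rev_rcons /=; have [->|_] := eqVneq x e.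
  by rewrite subseq_rev; right; exists L.
by rewrite -rev_rcons subseq_rev; left.
Qed.

Lemma ev_rcons s e x : ev a b (rcons s e) x = a e * ev a b s x + b e.
Proof. by rewrite -cats1 ev_cat. Qed.

(** Monotonicity of the last function [e] allows replacing what precedes it by the best choice of
    the same length. *)
Lemma best_keep l e m L0 L : best l m L0 -> best l m.+1 L ->
  ev a b (rcons L0 e) c <= ev a b L c -> best (rcons l e) m.+1 L.
Proof.
move=> [s0 sub0 max0] [sL subL maxL] le; split=> //.
  by apply: subseq_trans subL _; apply: subseq_rcons.
move=> L' /subseq_rcons_inv[sub|[L'' -> sub]]; first exact: maxL.
rewrite size_rcons => -[s'']; apply: le_trans le; rewrite !ev_rcons lerD2r ler_wpM2l //.
exact: max0.
Qed.

(** The hypothesis ranges over competitors instead of naming a best one, so it also covers an [l]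
    too short to have any. *)
Lemma best_extend l e m L0 : best l m L0 ->
  (forall L', subseq L' l -> size L' = m.+1 -> ev a b L' c <= ev a b (rcons L0 e) c) ->
  best (rcons l e) m.+1 (rcons L0 e).
Proof.
move=> [s0 sub0 max0] H; split=> [||L'].
- by rewrite size_rcons s0.
- by rewrite -!cats1 cat_subseq.
- case/subseq_rcons_inv => [sub|[L'' -> sub]]; first exact: H.
  rewrite size_rcons => -[s'']; rewrite !ev_rcons lerD2r ler_wpM2l //; exact: max0.
Qed.
End BestSubsequence.

(** A linked list read from node [p], all of whose nodes are among those allocated so far. There is
    no end marker: the length is known, and any pointer represents the empty list. *)
Fixpoint chain (fn par : nat -> nat) (cnt p : nat) (L : seq nat) : Prop :=
  match L with
  | [::] => True
  | e :: L' => [/\ (p <= cnt)%N, fn p = e & chain fn par cnt (par p) L']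
  end.

Lemma chain_mono fn par fn' par' cnt cnt' p L :
  (forall i, (i <= cnt)%N -> fn' i = fn i) -> (forall i, (i <= cnt)%N -> par' i = par i) ->
  (cnt <= cnt')%N -> chain fn par cnt p L -> chain fn' par' cnt' p L.
Proof.
move=> Hfn Hpar le; elim: L p => //= e L IH p [p_le fn_p ch]; split.
- exact: leq_trans le.
- by rewrite Hfn.
- by rewrite Hpar //; apply: IH.
Qed.

(** * Running programs *)

Section Programs.
Variable R : realType.
Implicit Types (st : state R) (Q : state R -> Prop).

Definition setn st A i v := State (update (nmem st) A i v) (rmem st).
Definition setr st A i v := State (nmem st) (update (rmem st) A i v).

Definition runs P st t Q :=
  exists st' t', [/\ exec P st st' t', (t' <= t)%N & Q st'].

Lemma runs_weaken P st t t' Q Q' :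
  runs P st t Q -> (t <= t')%N -> (forall st', Q st' -> Q' st') -> runs P st t' Q'.
Proof.
move=> [st' [u [ex le q]]] tt' QQ'; exists st', u; split=> //; last exact: QQ'.
exact: leq_trans tt'.
Qed.

Lemma runs_seq P P' st t t' Q :
  runs P st t (fun st' => runs P' st' t' Q) -> runs (Seq P P') st (t + t') Q.
Proof.
move=> [st1 [u [ex le [st2 [u' [ex' le' q]]]]]]; exists st2, (u + u')%N.
by split=> //; [apply: ExecSeq ex ex' | apply: leq_add].
Qed.

Fixpoint straight (P : cmd) : bool :=
  match P with
  | Seq P P' | If _ P P' => straight P && straight P'
  | While _ _ => false
  | _ => true
  end.

Fixpoint effect (P : cmd) st : state R :=
  match P with
  | NSet A i e => setn st A (neval st i) (neval st e)
  | RSet A i e => setr st A (neval st i) (reval st e)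
  | Seq P P' => effect P' (effect P st)
  | If b P P' => if beval st b then effect P st else effect P' st
  | _ => st
  end.

(** Adding both branches of a conditional, instead of taking their maximum, costs only a constant
    factor. *)
Fixpoint worst_cost (P : cmd) : nat :=
  match P with
  | NSet A i e => (ncost i + ncost e).+1
  | RSet A i e => (ncost i + rcost e).+1
  | Seq P P' => worst_cost P + worst_cost P'
  | If b P P' => (bcost b + (worst_cost P + worst_cost P')).+1
  | _ => 1
  end.

Lemma runs_straight P st t Q :
  straight P -> (worst_cost P <= t)%N -> Q (effect P st) -> runs P st t Q.
Proof.
move=> sP le q; suff [u [ex u_le]] : exists u, exec P st (effect P st) u /\ (u <= worst_cost P)%N.
  by exists (effect P st), u; split=> //; apply: leq_trans le.
elim: P st sP {le q} => [|A i e|A i e|P IH P' IH'|b P IH P' IH'|//] st /=.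
- by exists 1%N; split=> //; constructor.
- by exists (ncost i + ncost e).+1; split=> //; constructor.
- by exists (ncost i + rcost e).+1; split=> //; constructor.
- case/andP=> /(IH st) [u [ex le]] /(IH' (effect P st)) [u' [ex' le']].
  by exists (u + u')%N; split; [apply: ExecSeq ex ex' | apply: leq_add].
- case/andP=> /(IH st) [u [ex le]] /(IH' st) [u' [ex' le']].
  case eb : (beval st b); [exists (bcost b + u).+1 | exists (bcost b + u').+1]; split.
  + by constructor; rewrite eb.
  + by rewrite ltnS leq_add2l; apply: leq_trans le (leq_addr _ _).
  + by constructor; rewrite eb.
  + by rewrite ltnS leq_add2l; apply: leq_trans le' (leq_addl _ _).
Qed.

Definition For (x : nat) (N : nexp) (body : cmd) : cmd :=
  Seq (NSet x (NConst 0) (NConst 0))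
    (While (NLe (NAdd (NGet x (NConst 0)) (NConst 1)) N)
      (Seq body (NSet x (NConst 0) (NAdd (NGet x (NConst 0)) (NConst 1))))).

(** The invariant is stated after the increment of the counter. Besides body and bound, a round
    costs 5 for the test, 6 for the increment and 1 for the loop; initialization and last test cost
    9, rounded up to 12. *)
Lemma runs_for x e body st N T (I : nat -> state R -> Prop) Q :
  I 0%N (setn st x 0 0) ->
  (forall i st, (i <= N)%N -> I i st -> neval st e = N /\ nmem st x 0 = i) ->
  (forall i st, (i < N)%N -> I i st ->
     runs body st T (fun st' => nmem st' x 0 = i /\ I i.+1 (setn st' x 0 i.+1))) ->
  (forall st, I N st -> Q st) ->
  runs (For x e body) st (N * (T + ncost e + 12) + ncost e + 12) Q.
Proof.
move=> I0 Ie Ibody IQ.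
have loop m : forall i st', (i + m = N)%N -> I i st' ->
    runs (While (NLe (NAdd (NGet x (NConst 0)) (NConst 1)) e)
      (Seq body (NSet x (NConst 0) (NAdd (NGet x (NConst 0)) (NConst 1)))))
      st' (m * (T + ncost e + 12) + ncost e + 6) Q.
  elim: m => [|m IH] i st' im Ii.
    have [e_N x_i] := Ie i st' (eq_leq (etrans (esym (addn0 i)) im)) Ii.
    exists st', (bcost (NLe (NAdd (NGet x (NConst 0)) (NConst 1)) e)).+1; split.
    - by apply: ExecWhileStop => /=; rewrite e_N x_i -im addn0 addn1 ltnn.
    - by rewrite /=; lia.
    - by apply: IQ; rewrite -im addn0.
  have iN : (i < N)%N by lia.
  have [e_N x_i] := Ie i st' (ltnW iN) Ii.
  have [st1 [u [ex u_le [x_i' I1]]]] := Ibody i st' iN Ii.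
  have [|st2 [u' [ex' u'_le q]]] := IH i.+1 _ _ I1; first by lia.
  exists st2, ((4 + ncost e).+1 + (u + 6) + u').+1; split; [| lia | exact: q].
  apply: (ExecWhileStep (P := Seq _ _) _ _ ex'); first by rewrite /= e_N x_i addn1.
  apply: ExecSeq ex _; have := ExecNSet x (NConst 0) (NAdd (NGet x (NConst 0)) (NConst 1)) st1.
  by rewrite /= x_i' addn1.
have [|st' [u [ex le q]]] := loop N 0%N _ _ I0; first by [].
exists st', (3 + u)%N; split; [| lia | exact: q].
by apply: ExecSeq ex; apply: (ExecNSet x (NConst 0) (NConst 0) st).
Qed.
End Programs.

(** * The algorithm *)

(* [a...] names an array, [v...] a scalar kept in cell 0; the last four are arrays of reals. *)
Local Notation aOut := 1%N (only parsing).
Local Notation aCls := 2%N (only parsing).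
Local Notation aOrd := 4%N (only parsing).
Local Notation aNode := 5%N (only parsing).
Local Notation aFn := 6%N (only parsing).
Local Notation aPar := 7%N (only parsing).
Local Notation aUsed := 8%N (only parsing).
Local Notation vI := 10%N (only parsing).
Local Notation vJ := 11%N (only parsing).
Local Notation vR := 12%N (only parsing).
Local Notation vCnt := 13%N (only parsing).
Local Notation vBest := 14%N (only parsing).
Local Notation vE := 15%N (only parsing).
Local Notation vP := 16%N (only parsing).
Local Notation vRank := 17%N (only parsing).
Local Notation vFill := 18%N (only parsing).
Local Notation aWt := 3%N (only parsing).
Local Notation aVal := 4%N (only parsing).
Local Notation vMax := 5%N (only parsing).
Local Notation vCand := 6%N (only parsing).
Local Notation var x := (NGet x (NConst 0)) (only parsing).
Local Notation assign x e := (NSet x (NConst 0) e) (only parsing).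
Local Notation sizeN := (NGet 0 (NConst 0)) (only parsing).
Local Notation sizeK := (NGet 0 (NConst 1)) (only parsing).
Local Notation slopeOf e := (RGet 1 e) (only parsing).
Local Notation interceptOf e := (RGet 2 e) (only parsing).

Definition classify_step : cmd :=
  Seq (RSet aWt (var vI) (RDiv (interceptOf (var vI)) (RSub ROne (slopeOf (var vI)))))
    (If (RLe ROne (slopeOf (var vI)))
       (If (RLe (slopeOf (var vI)) ROne)
          (If (RLe RZero (interceptOf (var vI)))
             (NSet aCls (var vI) (NConst 1))
             (NSet aCls (var vI) (NConst 3)))
          (NSet aCls (var vI) (NConst 2)))
       (NSet aCls (var vI) (NConst 0))).
Definition classify : cmd := For vI sizeN classify_step.

Definition rank_step : cmd :=
  If (BAnd (NLe (NGet aCls (var vJ)) (NGet aCls (var vI)))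
       (BNot (BAnd (NLe (NGet aCls (var vI)) (NGet aCls (var vJ)))
         (BNot (BAnd (RLe (RGet aWt (var vJ)) (RGet aWt (var vI)))
           (BNot (BAnd (RLe (RGet aWt (var vI)) (RGet aWt (var vJ)))
             (NLe (var vI) (var vJ)))))))))
    (assign vRank (NAdd (var vRank) (NConst 1)))
    Skip.
(* The sorted sequence is stored twice in a row, so that its rotation by [r] occupies the cells
  [r, ..., r + n - 1]. *)
Definition place_step : cmd :=
  Seq (NSet aOrd (var vRank) (var vI)) (NSet aOrd (NAdd (var vRank) sizeN) (var vI)).
Definition sort_indices : cmd :=
  For vI sizeN (Seq (assign vRank (NConst 0)) (Seq (For vJ sizeN rank_step) place_step)).

Local Notation cellM := (NSub sizeK (var vJ)) (only parsing).
Local Notation cellM1 := (NSub cellM (NConst 1)) (only parsing).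

(* Cell [m] of [aVal] holds the best value of [m] functions chosen among those seen so far in the
  current rotation; cell [m] of [aNode] points to the choice itself, a linked list through [aPar]
  which shares its tail with the list of cell [m - 1] at the time of its creation.  The cells are
  visited in the order m = k, ..., 1. *)
Definition extend_cell : cmd :=
  Seq (assign vCnt (NAdd (var vCnt) (NConst 1)))
  (Seq (NSet aFn (var vCnt) (var vE))
  (Seq (NSet aPar (var vCnt) (NGet aNode cellM1))
  (Seq (NSet aNode cellM (var vCnt))
       (RSet aVal cellM (RGet vCand (NConst 0)))))).
Definition cell_step : cmd :=
  If (NLe cellM (NAdd (var vI) (NConst 1)))
    (Seq (RSet vCand (NConst 0)
            (RAdd (RMul (slopeOf (var vE)) (RGet aVal cellM1)) (interceptOf (var vE))))
      (If (BAnd (NLe cellM (var vI)) (RLe (RGet vCand (NConst 0)) (RGet aVal cellM)))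
        Skip extend_cell))
    Skip.
Definition element_step : cmd :=
  Seq (assign vE (NGet aOrd (NAdd (var vR) (var vI)))) (For vJ sizeK cell_step).
Definition record_best : cmd :=
  If (BAnd (NLe (NConst 1) (var vR)) (RLe (RGet aVal sizeK) (RGet vMax (NConst 0))))
    Skip
    (Seq (RSet vMax (NConst 0) (RGet aVal sizeK)) (assign vBest (NGet aNode sizeK))).
Definition rotation_step : cmd :=
  Seq (RSet aVal (NConst 0) (RGet 0 (NConst 0))) (Seq (For vI sizeN element_step) record_best).
Definition search : cmd := For vR sizeN rotation_step.

Definition clear_used : cmd := For vI sizeN (NSet aUsed (var vI) (NConst 0)).
Definition trace_step : cmd :=
  Seq (NSet aOut cellM1 (NGet aFn (var vP)))
  (Seq (NSet aUsed (NGet aFn (var vP)) (NConst 1)) (assign vP (NGet aPar (var vP)))).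
Definition trace_back : cmd := Seq (assign vP (var vBest)) (For vJ sizeK trace_step).
Definition fill_step : cmd :=
  If (NLe (NGet aUsed (var vI)) (NConst 0))
    (Seq (NSet aOut (var vFill) (var vI)) (assign vFill (NAdd (var vFill) (NConst 1))))
    Skip.
Definition fill_rest : cmd := Seq (assign vFill sizeK) (For vI sizeN fill_step).

Definition composition_ordering : cmd :=
  Seq classify (Seq sort_indices (Seq search (Seq clear_used (Seq trace_back fill_rest)))).

(** * Correctness and running time of the program *)

Section Correctness.
Variables (R : realType) (n k : nat) (a b : nat -> R) (c : R).
Implicit Types st : state R.

Record input_ok st : Prop := InputOk {
  in_n : nmem st 0 0 = n;
  in_k : nmem st 0 1 = k;
  in_c : rmem st 0 0 = c;
  in_a : forall i, rmem st 1 i = a i;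
  in_b : forall i, rmem st 2 i = b i }.

Definition keys_ok m st : Prop :=
  forall j, (j < m)%N -> nmem st aCls j = cls a b j /\ rmem st aWt j = wt a b j.

Lemma classify_stepE st i : input_ok st -> nmem st vI 0 = i ->
  effect classify_step st = setn (setr st aWt i (wt a b i)) aCls i (cls a b i).
Proof.
by case=> _ _ _ ha hb hi; rewrite /= /update /= hi !ha !hb /cls; case: ifP; do ?case: ifP.
Qed.

Lemma classify_runs st : input_ok st ->
  runs classify st (n * 100 + 100) (fun st' => input_ok st' /\ keys_ok n st').
Proof.
move=> in_st; pose I i st := [/\ input_ok st, nmem st vI 0 = i & keys_ok i st].
apply: (runs_weaken (Q := fun st' => input_ok st' /\ keys_ok n st') (t := n * (60 + 2 + 12) + 2 + 12)) => //; last by lia.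
apply: (runs_for (I := I)).
- by split=> //; case: in_st => *; constructor.
- by move=> i st1 _ [[]].
- move=> i st1 _ [in1 i1 k1]; apply: runs_straight => //.
  rewrite (classify_stepE in1 i1); split=> //.
  split=> //; first by case: in1 => *; constructor.
  move=> j; rewrite /keys_ok /= /update /=; have [->|ji] := eqVneq j i => // ji1.
  by apply: k1; lia.
- by move=> st1 [].
Qed.

Definition order_ok st : Prop :=
  forall m, (m < n)%N -> nmem st aOrd m = nth 0%N (angular_order a b n) m /\
    nmem st aOrd (m + n)%N = nth 0%N (angular_order a b n) m.

Lemma rank_stepE st i j : nmem st vI 0 = i -> nmem st vJ 0 = j -> keys_ok n st ->
  (i < n)%N -> (j < n)%N ->
  effect rank_step st = if before a b j i then setn st vRank 0 (nmem st vRank 0).+1 else st.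
Proof.
move=> hi hj hk /hk[ci wi] /hk[cj wj].
by rewrite /= hi hj ci wi cj wj before_nested addn1.
Qed.

Lemma sort_indices_runs st : input_ok st -> keys_ok n st ->
  runs sort_indices st (n * (n * 100 + 100) + 100) (fun st' => input_ok st' /\ order_ok st').
Proof.
move=> in_st k_st.
pose I i st := [/\ input_ok st, keys_ok n st, nmem st vI 0 = i &
  forall j, (j < i)%N -> nmem st aOrd (rank a b n j) = j /\ nmem st aOrd (rank a b n j + n) = j].
apply: (runs_weaken (Q := fun st' => input_ok st' /\ order_ok st')
  (t := n * (3 + (n * (60 + 2 + 12) + 2 + 12 + 20) + 2 + 12) + 2 + 12)) => //; last by lia.
apply: (runs_for (I := I)).
- by split=> //; case: in_st => *; constructor.
- by move=> i st1 _ [[]].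
- move=> i st1 i_n [in1 k1 i1 o1]; apply: runs_seq; apply: runs_straight => //=.
  pose J j st := [/\ input_ok st, keys_ok n st, nmem st vI 0 = i, nmem st vJ 0 = j &
    nmem st vRank 0 = count ((before a b)^~ i) (iota 0 j) /\ nmem st aOrd =1 nmem st1 aOrd].
  apply: runs_seq; apply: (runs_for (I := J)).
  + by split=> //; case: in1 => *; constructor.
  + by move=> j st2 _ [[]].
  + move=> j st2 j_n [in2 k2 i2 j2 [r2 o2]]; apply: runs_straight => //.
    rewrite (rank_stepE i2 j2 k2 i_n j_n); split; first by case: ifP.
    have count_S : count ((before a b)^~ i) (iota 0 j.+1) =
        (count ((before a b)^~ i) (iota 0 j) + before a b j i)%N.
      by rewrite -addn1 iotaD count_cat /= addn0.
    rewrite /J count_S.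
    by case: ifP => h; split=> //=; rewrite ?h ?r2 /update /= ?addn0 ?addn1 //; case: in2 => *; constructor.
  + move=> st2 [in2 k2 i2 j2 [r2 o2]]; apply: runs_straight => //; split=> //.
    split=> //=.
    * by case: in2 => *; constructor.
    * move=> j j_i; rewrite /update /= /update /= i2 r2 -/(rank a b n i) (in_n in2).
      have j_n : (j < n)%N by lia.
      have := rank_lt a b i_n; have := rank_lt a b j_n => rj ri.
      rewrite eqn_add2r !o2; have -> : (rank a b n j == (rank a b n i + n)%N) = false by lia.
      have -> : ((rank a b n j + n)%N == rank a b n i) = false by lia.
      have [/(rank_inj j_n i_n) ->//|ji] := eqVneq.
      by apply: o1; rewrite ltn_neqAle -ltnS j_i andbT; apply: contraNneq ji => ->.
- move=> st1 [in1 _ _ o1]; split=> // m m_n; have := rank_nth a b m_n.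
  set e := nth _ _ m => re; have e_n : (e < n)%N by rewrite -(mem_order a b) mem_nth // size_order.
  by have := o1 e e_n; rewrite re.
Qed.

Hypothesis a_ge0 : forall i, 0 <= a i.

Let ord := angular_order a b n.

(** The list is reversed because its first node carries the function applied last. *)
Definition holds st p L : Prop := chain (nmem st aFn) (nmem st aPar) (nmem st vCnt 0) p (rev L).

Definition grows st st' : Prop :=
  [/\ (nmem st vCnt 0 <= nmem st' vCnt 0)%N,
      forall i, (i <= nmem st vCnt 0)%N -> nmem st' aFn i = nmem st aFn i &
      forall i, (i <= nmem st vCnt 0)%N -> nmem st' aPar i = nmem st aPar i].

Lemma holds_grows st st' p L : grows st st' -> holds st p L -> holds st' p L.
Proof. by case=> le fn_eq par_eq; apply: chain_mono. Qed.

(** A cell with [m > i] may hold a stale value of an earlier rotation; the two length tests of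
    [cell_step] keep such values from being read as results. *)
Definition cell_ok l i m st : Prop := (m <= i)%N ->
  exists L, [/\ best a b c (take i l) m L, holds st (nmem st aNode m) L &
    rmem st aVal m = ev a b L c].

(** Nothing is claimed of the value for [r = 0], when [vMax] is not yet set; accordingly
    [record_best] always stores the first rotation. *)
Definition recorded r st : Prop := exists2 L, holds st (nmem st vBest 0) L & ((0 < r)%N ->
  [/\ size L = k, exists2 r', (r' < n)%N & subseq L (rot r' ord), rmem st vMax 0 = ev a b L c &
    forall r' L', (r' < r)%N -> subseq L' (rot r' ord) -> size L' = k ->
      ev a b L' c <= ev a b L c]).

(** After [j] inner steps the cells above [k - j] already describe the prefix of length [i + 1], the
    others still the one of length [i]. *)
Record dp_ok r i j st : Prop := DpOk {
  dp_in : input_ok st;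
  dp_order : order_ok st;
  dp_r : nmem st vR 0 = r;
  dp_i : nmem st vI 0 = i;
  dp_rec : recorded r st;
  dp_cells : forall m, (m <= k)%N -> cell_ok (rot r ord) (i + (k - j < m)) m st }.

Lemma cell_ok_grows l i m st st' : grows st st' ->
  nmem st' aNode m = nmem st aNode m -> rmem st' aVal m = rmem st aVal m ->
  cell_ok l i m st -> cell_ok l i m st'.
Proof.
move=> g hn hv ok /ok[L [bL hL vL]]; exists L; split=> //; last by rewrite hv.
by rewrite hn; apply: holds_grows hL.
Qed.

Lemma recorded_grows r st st' : grows st st' -> nmem st' vBest 0 = nmem st vBest 0 ->
  rmem st' vMax 0 = rmem st vMax 0 -> recorded r st -> recorded r st'.
Proof.
move=> g hb hm [L hL rL]; exists L; first by rewrite hb; apply: holds_grows hL.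
by rewrite hm.
Qed.

Lemma extend_cellE st j m : input_ok st -> nmem st vJ 0 = j -> (k - j = m.+1)%N ->
  let p := (nmem st vCnt 0).+1 in
  effect extend_cell st =
    setr (setn (setn (setn (setn st vCnt 0 p) aFn p (nmem st vE 0)) aPar p (nmem st aNode m))
      aNode m.+1 p) aVal m.+1 (rmem st vCand 0).
Proof.
move=> in_st j_st km /=; have m1 : (m.+1 - 1 = m)%N by lia.
by do 6!rewrite /update /=; rewrite (in_k in_st) j_st km m1 addn1.
Qed.

Lemma cell_stepE st i j e m : input_ok st -> nmem st vI 0 = i -> nmem st vJ 0 = j ->
  nmem st vE 0 = e -> (k - j = m.+1)%N ->
  let v := a e * rmem st aVal m + b e in
  effect cell_step st =
    if (m <= i)%N then
      if (m < i)%N && (v <= rmem st aVal m.+1) then setr st vCand 0 v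
      else effect extend_cell (setr st vCand 0 v)
    else st.
Proof.
move=> in_st i_st j_st e_st km v; have m1 : (m.+1 - 1 = m)%N by lia.
rewrite [LHS]/= -/(effect extend_cell _).
rewrite (in_k in_st) j_st km m1 e_st (in_a in_st) (in_b in_st) i_st.
by rewrite addn1.
Qed.

Lemma cell_step_ok r i j e st : (i < n)%N -> (j < k)%N -> nmem st vE 0 = e ->
  nth 0%N (rot r ord) i = e -> nmem st vJ 0 = j -> dp_ok r i j st ->
  dp_ok r i j.+1 (effect cell_step st).
Proof.
move=> i_n j_k e_st e_nth j_st [in_st or_st r_st i_st rec cells].
set l := rot r ord in e_nth cells *.
have size_l : size l = n by rewrite size_rot size_order.
have take_l : take i.+1 l = rcons (take i l) e.
  by rewrite -e_nth -(take_nth 0%N) // size_l.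
have [m km] : exists m, (k - j = m.+1)%N by exists (k - j).-1; lia.
have m1 : (m.+1 - 1 = m)%N by lia.
have old m' : m' != m.+1 -> (k - j.+1 < m')%N = (k - j < m')%N by lia.
rewrite (cell_stepE in_st i_st j_st e_st km).
have [m_i|i_m] := leqP m i; last first.
  split=> // m' m'k; have [->|/old ->] := eqVneq m' m.+1; last exact: cells.
  by rewrite (_ : (_ < _)%N) ?addn1 /cell_ok; lia.
have m_k0 : (m <= k)%N by lia.
(* Descending order matters here: cell [m] has not been updated in this round, so it cannot already
   contain [e]. *)
have km0 : (k - j < m)%N = false by lia.
have := cells m m_k0; rewrite km0 addn0 => /(_ m_i) [L0 [best0 holds0 val0]].
have km1 : (k - j < m.+1)%N = false by lia.
have m_k : (m.+1 <= k)%N by lia.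
have jm1 : (k - j.+1 < m.+1)%N by lia.
set v := _ + _.
have v_ev : v = ev a b (rcons L0 e) c by rewrite ev_rcons -val0.
case: ifP => [/andP[m_lt v_le]|v_gt].
  have := cells m.+1 m_k; rewrite km1 addn0 => /(_ m_lt) [L [bestL holdsL valL]].
  split=> //; first by case: in_st => *; constructor.
  move=> m' m'k; have [->|/old ->] := eqVneq m' m.+1; last exact: cells.
  rewrite jm1 addn1 => _; exists L; split=> //; rewrite take_l.
  by apply: best_keep best0 bestL _ => //; rewrite -v_ev -valL.
set st1 := setr st vCand 0 v.
have in_st1 : input_ok st1 by case: in_st => *; constructor.
rewrite (extend_cellE in_st1 j_st km) [nmem st1 vE 0]e_st; set p := (nmem st1 vCnt 0).+1; set st2 := setr _ _ _ _.
have grow : grows st st2.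
  have ne x : (x <= nmem st vCnt 0)%N -> (x == p) = false by rewrite /p /=; lia.
  by split=> [|x /ne|x /ne]; rewrite /= /update /= /p //= => ->.
have in_st2 : input_ok st2 by case: in_st => *; constructor.
split=> //; first exact: recorded_grows rec.
move=> m' m'k; have [->|m'm] := eqVneq m' m.+1; last first.
  rewrite old //; apply: cell_ok_grows (cells m' m'k) => //=; rewrite /update /= (negPf m'm) //.
rewrite jm1 addn1 /cell_ok take_l => _; exists (rcons L0 e); split.
- apply: best_extend => // L' sub sz.
  (* For [m = i] cell [m.+1] is not yet valid, and a prefix of length [i] has no subsequence that
     long. *)
  have [m_lt|m_ge] := ltnP m i; last first.
    have := size_subseq sub; rewrite sz size_take size_l i_n; lia.
  have := cells m.+1 m_k; rewrite km1 addn0 => /(_ m_lt) [L [bestL holdsL valL]].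
  have [_ _ /(_ _ sub sz)] := bestL.
  move: v_gt; rewrite m_lt /= valL -v_ev => /negbT; rewrite -ltNge => /ltW vL Ll.
  exact: le_trans Ll vL.
- rewrite /holds rev_rcons /= /update /= !eqxx; split=> //.
  exact: (holds_grows grow holds0).
- by rewrite /= /update /= eqxx -v_ev.
Qed.
Lemma dp_ok_var r i j x v st : (x == vJ) || (x == vE) ->
  dp_ok r i j st -> dp_ok r i j (setn st x 0 v).
Proof.
by case/orP=> /eqP-> [in_st or_st r_st i_st rec cells];
  split=> //; case: in_st => *; constructor.
Qed.

Lemma dp_ok_next r i st : dp_ok r i k st -> dp_ok r i.+1 0 (setn st vI 0 i.+1).
Proof.
case=> in_st or_st r_st i_st rec cells; split=> //; first by case: in_st => *; constructor.
move=> m m_k; have := cells m m_k; rewrite subnn subn0 (_ : (k < m)%N = false) ?addn0; last by lia.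
(* Cell 0 is never visited, but the empty list is best of length 0 for every prefix. *)
case: m m_k => [|m] _; last by rewrite addn1.
move=> /(_ isT) [L [[/size0nil -> _ _] _ val0]] _; exists [::]; split=> //; exact: best0.
Qed.

Lemma element_step_runs r i st : (r < n)%N -> (i < n)%N -> dp_ok r i 0 st ->
  runs element_step st (k * 300 + 100)
    (fun st' => nmem st' vI 0 = i /\ dp_ok r i.+1 0 (setn st' vI 0 i.+1)).
Proof.
move=> r_n i_n ok; apply: (runs_weaken (t := 10 + (k * (200 + 2 + 12) + 2 + 12))) => [||? h]; [|lia|exact: h].
apply: runs_seq; apply: runs_straight => //=.
rewrite (dp_r ok) (dp_i ok).
pose e := nth 0%N (rot r ord) i.
have -> : nmem st aOrd (r + i) = e.
  rewrite /e /rot nth_cat size_drop size_order nth_drop.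
  (* Past the end of the first copy of the sorted sequence, the second copy is read. *)
  have [i_lt|i_ge] := ltnP i (n - r).
    by have [->] := dp_order ok (m := (r + i)%N) ltac:(lia).
  rewrite nth_take; last by lia.
  have [_ <-] := dp_order ok (m := (i - (n - r))%N) ltac:(lia).
  by congr (nmem st aOrd _); lia.
pose J j st := [/\ dp_ok r i j st, nmem st vJ 0 = j & nmem st vE 0 = e].
apply: (runs_for (I := J)).
- by split=> //; do 2!apply: dp_ok_var => //.
- by move=> j st1 _ [[[]]].
- move=> j st1 j_k [ok1 j1 e1]; apply: runs_straight => //.
  have keep x : (x == vJ) || (x == vE) -> nmem (effect cell_step st1) x 0 = nmem st1 x 0.
    by case/orP=> /eqP->; rewrite /cell_step /=; case: ifP => // _; case: ifP.
  rewrite keep //; split=> //; split=> //; last by rewrite -e1 -(keep vE).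
  by apply: dp_ok_var => //; apply: (cell_step_ok i_n j_k e1 (erefl _) j1 ok1).
- move=> st1 [ok1 _ _]; split; [exact: dp_i ok1 | exact: dp_ok_next].
Qed.

Lemma rotation_step_runs r st : (r < n)%N -> (k <= n)%N ->
  input_ok st -> order_ok st -> nmem st vR 0 = r -> recorded r st ->
  runs rotation_step st (n * (k * 300 + 200) + 100)
    (fun st' => [/\ nmem st' vR 0 = r, input_ok st', order_ok st' & recorded r.+1 st']).
Proof.
move=> r_n k_n in_st or_st r_st rec.
apply: (runs_weaken (t := 10 + ((n * (k * 300 + 100 + 2 + 12) + 2 + 12) + 60))) => [||? h]; [|lia|exact: h].
apply: runs_seq; apply: runs_straight => //=; rewrite (in_c in_st).
apply: runs_seq; apply: (runs_for (I := fun i => dp_ok r i 0)).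
- split=> //; first by case: in_st => *; constructor.
  move=> m m_k; rewrite /cell_ok subn0 (_ : (k < m)%N = false) ?addn0; last by lia.
  by rewrite leqn0 => /eqP->; exists [::]; split=> //; exact: best0.
- by move=> i st1 _ [[]].
- by move=> i st1 i_n; apply: element_step_runs.
move=> st1 ok; apply: runs_straight => //=.
have [in1 or1 r1 _ rec1 cells] := ok.
have [L [bestL holdsL valL]] : exists L, [/\ best a b c (rot r ord) k L,
    holds st1 (nmem st1 aNode k) L & rmem st1 aVal k = ev a b L c].
  have := cells k (leqnn k); rewrite subn0 ltnn addn0 => /(_ k_n).
  by rewrite take_oversize ?size_rot ?size_order.
rewrite r1 (in_k in1) valL.
case: ifP => [/andP[r_gt0 le]|gt].
- split=> //; have [L1 h1 rL1] := rec1; exists L1 => // _.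
  have [sz sub vm mx] := rL1 r_gt0; split=> // r' L'; rewrite ltnS leq_eqVlt => /predU1P[->|r'r].
    by have [_ _ mxL] := bestL => sub' sz'; apply: (le_trans (mxL _ sub' sz')); rewrite -vm.
  exact: mx.
- split=> //; first by case: in1 => *; constructor.
  exists L; first by [].
  move=> _; have [szL subL mxL] := bestL; split=> //; first by exists r.
  move=> r' L'; rewrite ltnS leq_eqVlt => /predU1P[->|r'r]; first exact: mxL.
  have [L1 h1 rL1] := rec1; have r_gt0 : (0 < r)%N by lia.
  have [sz sub vm mx] := rL1 r_gt0 => sub' sz'; apply: (le_trans (mx _ _ r'r sub' sz')).
  by move: gt; rewrite r_gt0 /= vm => /negbT; rewrite -ltNge => /ltW.
Qed.

Lemma search_runs st : (k <= n)%N -> input_ok st -> order_ok st ->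
  runs search st (n * (n * (k * 300 + 200) + 200) + 100)
    (fun st' => input_ok st' /\ recorded n st').
Proof.
move=> k_n in_st or_st; pose I r st := [/\ nmem st vR 0 = r, input_ok st, order_ok st & recorded r st].
apply: (runs_weaken (t := n * (n * (k * 300 + 200) + 100 + 2 + 12) + 2 + 12)) => [||? h]; [|lia|exact: h].
apply: (runs_for (I := I)).
- split=> //; first by case: in_st => *; constructor.
  by exists [::].
- by move=> r st1 _ [r1 []].
- move=> r st1 r_n [r1 in1 or1 rec1].
  apply: (runs_weaken (rotation_step_runs r_n k_n in1 or1 r1 rec1)) => //.
  move=> st2 [r2 in2 or2 rec2]; split=> //; split=> //; by case: in2 => *; constructor.
- by move=> st1 [].
Qed.

Definition used_ok (L : seq nat) st : Prop :=
  forall i, (i < n)%N -> nmem st aUsed i = (i \in L).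

Definition out_ok (L : seq nat) m st : Prop :=
  forall i, (m <= i < size L)%N -> nmem st aOut i = nth 0%N L i.

Lemma clear_used_runs L st : input_ok st -> holds st (nmem st vBest 0) L ->
  runs clear_used st (n * 100 + 100)
    (fun st' => [/\ input_ok st', holds st' (nmem st' vBest 0) L & used_ok [::] st']).
Proof.
move=> in_st hL; pose I i st := [/\ input_ok st, holds st (nmem st vBest 0) L, nmem st vI 0 = i &
  forall j, (j < i)%N -> nmem st aUsed j = 0%N].
apply: (runs_weaken (t := n * (60 + 2 + 12) + 2 + 12)) => [||? h]; [|lia|exact: h].
apply: (runs_for (I := I)).
- by split=> //; case: in_st => *; constructor.
- by move=> i st1 _ [[]].
- move=> i st1 i_n [in1 h1 i1 u1]; apply: runs_straight => //=; rewrite i1.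
  split=> //; split=> //; first by case: in1 => *; constructor.
  by move=> j; rewrite /= /update /=; have [//|ji] := eqVneq j i => j_i; apply: u1; lia.
- by move=> st1 [in1 h1 _ u1]; split.
Qed.

(** The linked list delivers the last function first, so the output cells are filled from [k - 1]
    down to 0. *)
Lemma trace_back_runs L st : size L = k -> all (gtn n) L ->
  input_ok st -> holds st (nmem st vBest 0) L -> used_ok [::] st ->
  runs trace_back st (k * 100 + 100)
    (fun st' => [/\ input_ok st', used_ok L st' & out_ok L 0 st']).
Proof.
move=> sz L_n in_st hL u_st; pose J j st := [/\ input_ok st, nmem st vJ 0 = j,
  holds st (nmem st vP 0) (take (k - j) L), used_ok (drop (k - j) L) st & out_ok L (k - j) st].
apply: (runs_weaken (t := 10 + (k * (60 + 2 + 12) + 2 + 12))) => [||? h]; [|lia|exact: h].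
apply: runs_seq; apply: runs_straight => //=; apply: (runs_for (I := J)).
- rewrite /J subn0 -sz take_size drop_size; split=> //; first by case: in_st => *; constructor.
  by move=> i /=; lia.
- by move=> j st1 _ [[]].
- move=> j st1 j_k [in1 j1 h1 u1 o1]; apply: runs_straight => //=.
  have [m km] : exists m, (k - j = m.+1)%N by exists (k - j).-1; lia.
  have km1 : (k - j.+1 = m)%N by lia.
  have m_L : (m < size L)%N by lia.
  move: h1 u1 o1; rewrite km (take_nth 0%N) // /holds rev_rcons /= => -[p_le fn_p h1] u1 o1.
  have e_n : (nth 0%N L m < n)%N by apply: (allP L_n); apply: mem_nth.
  rewrite (in_k in1) j1 km subn1 /= fn_p; do 2!rewrite {1}/update /=; split=> //.
  rewrite /J km1; split=> //; first by case: in1 => *; constructor.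
  + move=> i i_n; rewrite /= /update /= (drop_nth 0%N) // inE fn_p.
    by have [//|_ /=] := eqVneq i (nth 0%N L m); apply: u1.
  + move=> i i_m; rewrite /= /update /=; have [->//|im] := eqVneq i m.
    by apply: o1; lia.
- by rewrite /J subnn drop0 => st1 [in1 _ _ u1 o1].
Qed.

Definition completed (L : seq nat) (i : nat) : seq nat := L ++ [seq j <- iota 0 i | j \notin L].

Lemma completed_perm L : uniq L -> all (gtn n) L -> perm_eq (completed L n) (iota 0 n).
Proof.
move=> uL /allP L_n; apply: uniq_perm; rewrite ?iota_uniq //.
  rewrite cat_uniq uL filter_uniq ?iota_uniq // andbT /=.
  by apply/hasPn => i; rewrite mem_filter => /andP[].
move=> i; rewrite mem_cat mem_filter mem_iota /=.
by have [/L_n /= ->|//] := boolP (i \in L).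
Qed.

Lemma fill_rest_runs L st : size L = k -> input_ok st -> used_ok L st -> out_ok L 0 st ->
  runs fill_rest st (n * 100 + 100) (out_ok (completed L n) 0).
Proof.
move=> sz in_st u_st o_st; pose I i st := [/\ input_ok st, nmem st vI 0 = i, used_ok L st,
  nmem st vFill 0 = size (completed L i) & out_ok (completed L i) 0 st].
apply: (runs_weaken (t := 10 + (n * (60 + 2 + 12) + 2 + 12))) => [||? h]; [|lia|exact: h].
apply: runs_seq; apply: runs_straight => //=; apply: (runs_for (I := I)).
- rewrite /I /completed /= cats0; split=> //; first by case: in_st => *; constructor.
  by rewrite (in_k in_st).
- by move=> i st1 _ [[]].
- move=> i st1 i_n [in1 i1 u1 f1 o1]; apply: runs_straight => //=.
  rewrite i1 (u1 i i_n) leqn0 eqb0; rewrite /I.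
  have -> : completed L i.+1 = completed L i ++ [seq j <- [:: i] | j \notin L].
    by rewrite /completed -catA -filter_cat -addn1 iotaD.
  rewrite /=; case: ifP => _; last first.
    by rewrite cats0; split=> //; split=> //; case: in1 => *; constructor.
  split=> //; split=> //; first by case: in1 => *; constructor.
    by rewrite /= /update /= /update /= f1 addn1 size_cat addn1.
  move=> j; rewrite size_cat /= => j_lt; rewrite /update /= /update /= f1 nth_cat.
  have [->|jf] := eqVneq j; first by rewrite ltnn subnn.
  have -> : (j < size (completed L i))%N by lia.
  by apply: o1; lia.
- by move=> st1 [].
Qed.

Definition is_optimum (L : seq nat) : Prop :=
  [/\ size L = k, uniq L, all (gtn n) L &
    forall L', size L' = k -> uniq L' -> all (gtn n) L' -> ev a b L' c <= ev a b L c].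

Lemma recorded_optimum st : (k <= n)%N -> recorded n st ->
  exists2 L, holds st (nmem st vBest 0) L & is_optimum L.
Proof.
(* For [n = 0] no rotation is examined, and the empty list is the only candidate. *)
move=> k_n [L hL rL]; have [n0|n_gt0] := posnP n.
  have k0 : k = 0%N by lia.
  by exists [::] => //; split=> // L'; rewrite k0 => /size0nil ->.
exists L => //; have [sz [r r_n subL] _ mx] := rL n_gt0; split=> //.
- by apply: subseq_uniq subL _; rewrite rot_uniq order_uniq.
- by apply/allP => i /(mem_subseq subL); rewrite mem_rot mem_order.
move=> L' sz' u' /allP L'_n.
have L'_ord : {subset L' <= ord} by move=> i /L'_n; rewrite mem_order.
(* Every competitor is matched by its own rearrangement along some rotation, a subsequence that the
   search has taken into account. *)
have [||r' r'_n le] := @rotation _ a b a_ge0 ord L' c _ (order_uniq a b n) _ u' L'_ord.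
- by apply: sub_pairwise (order_pairwise a b n) => i j; apply: before_key.
- by rewrite size_order.
apply: (le_trans le); apply: (mx r') => //.
- by rewrite size_order in r'_n.
- exact: filter_subseq.
- rewrite -sz'; apply/perm_size/uniq_perm => //.
    by rewrite filter_uniq // rot_uniq order_uniq.
  by move=> i; rewrite mem_filter mem_rot; have [/L'_ord ->|] := boolP (i \in L').
Qed.

Lemma composition_ordering_runs st : (k <= n)%N -> input_ok st ->
  runs composition_ordering st (2000 * (maxn 1 k * maxn 1 n ^ 2))
    (fun st' => exists2 L, is_optimum L & out_ok (completed L n) 0 st').
Proof.
move=> k_n in_st.
(* The coefficients of the expanded sum add up to 1900, and each monomial is at most
   [maxn 1 k * maxn 1 n ^ 2]. *)
apply: (runs_weaken (t := n * 100 + 100 + (n * (n * 100 + 100) + 100 +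
  (n * (n * (k * 300 + 200) + 200) + 100 + (n * 100 + 100 + (k * 100 + 100 + (n * 100 + 100)))))))
  => [||? h]; [|nia|exact: h].
apply: runs_seq; apply: (runs_weaken (classify_runs in_st)) => // st1 [in1 keys1].
apply: runs_seq; apply: (runs_weaken (sort_indices_runs in1 keys1)) => // st2 [in2 or2].
apply: runs_seq; apply: (runs_weaken (search_runs k_n in2 or2)) => // st3 [in3 rec3].
have [L hL optL] := recorded_optimum k_n rec3; have [sz uL L_n _] := optL.
apply: runs_seq; apply: (runs_weaken (clear_used_runs in3 hL)) => // st4 [in4 hL4 u4].
apply: runs_seq; apply: (runs_weaken (trace_back_runs sz L_n in4 hL4 u4)) => // st5 [in5 u5 o5].
by apply: (runs_weaken (fill_rest_runs sz in5 u5 o5)) => // st6 o6; exists L.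
Qed.

End Correctness.

Lemma perm_of_seq (n : nat) (l : seq nat) : perm_eq l (iota 0 n) ->
  exists s : 'S_n, [seq val (s i) | i <- enum 'I_n] = l.
Proof.
move=> l_perm; have sz : size l = n by rewrite (perm_size l_perm) size_iota.
have lt i : (i < n)%N -> (nth 0%N l i < n)%N.
  move=> i_n; have : nth 0%N l i \in l by rewrite mem_nth // sz.
  by rewrite (perm_mem l_perm) mem_iota.
pose g (i : 'I_n) : 'I_n := Ordinal (lt i (ltn_ord i)).
have g_inj : injective g.
  move=> i j /(congr1 val) /= /eqP; rewrite nth_uniq ?sz //; first by move/eqP/val_inj.
  by rewrite (perm_uniq l_perm) iota_uniq.
exists (perm g_inj); under eq_map => i do rewrite permE /=.
by rewrite (map_comp (nth 0%N l) val) val_enum_ord -/(mkseq _ _) -sz mkseq_nth.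
Qed.

Theorem theorem2 (R : realType) :
  exists (P : cmd) (C : nat),
    forall (n k : nat) (a b : 'I_n -> R) (c : R),
      (k <= n)%N ->
      (forall i : 'I_n, 0 <= a i) ->
      exists (st : state R) (t : nat) (s : 'S_n),
        [/\ exec P (input_state k a b c) st t,
            (t <= C * (maxn 1 k * maxn 1 n ^ 2))%N,
            outputs st s
          & max_exact_composition (fun i x => a i * x + b i) c k s].
Proof.
exists composition_ordering, 2000%N => n k a b c k_n a_ge0.
(* The value 0 outside the index range is what the input memory holds there, and it keeps the slopes
   nonnegative. *)
pose a' i : R := oapp a 0 (insub i); pose b' i : R := oapp b 0 (insub i).
have a'_ge0 i : 0 <= a' i by rewrite /a'; case: insubP => [j _ _|_] /=.
have val_ev (s : 'S_n) : compose_value (fun i x => a i * x + b i) c k s =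
    ev a' b' (take k [seq val (s i) | i <- enum 'I_n]) c.
  rewrite /compose_value -map_take; elim: (take k _) c => //= i l IH x.
  by rewrite IH /a' /b' !valK.
have in_st : input_ok n k a' b' c (input_state k a b c) by [].
have [st [t [ex t_le [L optL outL]]]] := composition_ordering_runs a'_ge0 k_n in_st.
have [sz uL L_n mx] := optL.
have [s s_L] := perm_of_seq (completed_perm uL L_n).
exists st, t, s; split=> //.
  move=> i; rewrite outL; last by rewrite -s_L size_map size_enum_ord /=.
  by rewrite -s_L (nth_map i) ?size_enum_ord // nth_ord_enum.
move=> s'; rewrite !val_ev s_L /completed take_size_cat //; apply: mx.
- by rewrite size_takel // size_map size_enum_ord.
- apply: take_uniq; rewrite map_inj_uniq ?enum_uniq // => i j /val_inj; exact: perm_inj.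
- by apply/allP => i /mem_take /mapP[j _ ->] /=.
Qed.
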